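(* Let $\mathbf{L}\in\{\mathbf{I^1},\mathbf{I^2},\mathbf{P^1},\mathbf{P^2}\}$ and let $\varphi,\psi$ be $\mathbf{L}$-contingent formulas of the language of $\mathbf{L}$. If $\varphi\models_{\mathbf{L}}\psi$, then one can construct a formula $\chi$ of the language of $\mathbf{L}$ such that every atom of $\chi$ occurs in both $\varphi$ and $\psi$, $\varphi\models_{\mathbf{L}}\chi$, and $\chi\models_{\mathbf{L}}\psi$.
   Context: All four logics have formulas built from propositional atoms with $\neg,\wedge,\vee,\rightarrow$, interpreted by homomorphisms $h$ into $\{0,u,1\}$. $\mathbf{I^1}$: designated set $D=\{1\}$; $h(\varphi\wedge\psi)=1$ if $h(\varphi)=h(\psi)=1$ and $0$ otherwise; $h(\varphi\vee\psi)=1$ if $h(\varphi)=1$ or $h(\psi)=1$, and $0$ otherwise; $h(\varphi\rightarrow\psi)=0$ if $h(\varphi)=1$ and $h(\psi)\neq1$, and $1$ otherwise; negation is Heyting's: $\neg1=0,\ \neg u=0,\ \neg0=1$. $\mathbf{I^2}$: as $\mathbf{I^1}$ but with Kleene negation $\neg1=0,\ \neg u=u,\ \neg0=1$. $\mathbf{P^1}$: designated set $D=\{1,u\}$; $h(\varphi\wedge\psi)=1$ if $h(\varphi)\neq0$ and $h(\psi)\neq0$, and $0$ otherwise; $h(\varphi\vee\psi)=0$ if $h(\varphi)=h(\psi)=0$, and $1$ otherwise; $h(\varphi\rightarrow\psi)=0$ if $h(\varphi)\neq0$ and $h(\psi)=0$, and $1$ otherwise; negation is Bochvar's: $\neg1=0,\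 \neg u=1,\ \neg0=1$. $\mathbf{P^2}$: as $\mathbf{P^1}$ but with Kleene negation $\neg1=0,\ \neg u=u,\ \neg0=1$. $\varphi\models_{\mathbf{L}}\psi$ means: for every such homomorphism $h$, if $h(\varphi)\in D$ then $h(\psi)\in D$. A formula is $\mathbf{L}$-contingent iff there is a homomorphism giving it a designated value and one giving it a non-designated value. *)

(* Defs.v *)
From mathcomp Require Import all_boot.

Set Implicit Arguments.
Unset Strict Implicit.
Unset Printing Implicit Defensive.

Inductive form (A : Type) : Type :=
| Atom of A
| Neg of form A
| And of form A & form A
| Or of form A & form A
| Imp of form A & form A.

Fixpoint atoms (A : Type) (phi : form A) : seq A :=
  match phi with
  | Atom p => [:: p]
  | Neg phi1 => atoms phi1
  | And phi1 phi2 | Or phi1 phi2 | Imp phi1 phi2 => atoms phi1 ++ atoms phi2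
  end.

Inductive tval : Type := V0 | Vu | V1.

Inductive logic : Type := I1 | I2 | P1 | P2.

Definition designated (L : logic) (x : tval) : bool :=
  match L, x with
  | _, V1 => true
  | (P1 | P2), Vu => true
  | _, _ => false
  end.

Definition heyting_neg (x : tval) : tval :=
  match x with V1 => V0 | Vu => V0 | V0 => V1 end.

Definition kleene_neg (x : tval) : tval :=
  match x with V1 => V0 | Vu => Vu | V0 => V1 end.

Definition bochvar_neg (x : tval) : tval :=
  match x with V1 => V0 | Vu => V1 | V0 => V1 end.

Definition tneg (L : logic) : tval -> tval :=
  match L with
  | I1 => heyting_neg
  | P1 => bochvar_neg
  | I2 | P2 => kleene_neg
  end.

Definition tand (L : logic) (x y : tval) : tval :=
  match L with
  | I1 | I2 => match x, y with V1, V1 => V1 | _, _ => V0 end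
  | P1 | P2 => match x, y with V0, _ | _, V0 => V0 | _, _ => V1 end
  end.

Definition tor (L : logic) (x y : tval) : tval :=
  match L with
  | I1 | I2 => match x, y with V1, _ | _, V1 => V1 | _, _ => V0 end
  | P1 | P2 => match x, y with V0, V0 => V0 | _, _ => V1 end
  end.

Definition timp (L : logic) (x y : tval) : tval :=
  match L with
  | I1 | I2 => match x, y with V1, (V0 | Vu) => V0 | _, _ => V1 end
  | P1 | P2 => match x, y with (V1 | Vu), V0 => V0 | _, _ => V1 end
  end.

Definition homomorphism (A : Type) (L : logic) (h : form A -> tval) : Prop :=
  [/\ {morph h : phi / Neg phi >-> tneg L phi},
      {morph h : phi psi / And phi psi >-> tand L phi psi},
      {morph h : phi psi / Or phi psi >-> tor L phi psi} &
      {morph h : phi psi / Imp phi psi >-> timp L phi psi}].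

Definition entails (A : Type) (L : logic) (phi psi : form A) : Prop :=
  forall h : form A -> tval, homomorphism L h ->
    designated L (h phi) -> designated L (h psi).

Definition contingent (A : Type) (L : logic) (phi : form A) : Prop :=
  (exists h : form A -> tval, homomorphism L h /\ designated L (h phi)) /\
  (exists h : form A -> tval, homomorphism L h /\ ~~ designated L (h phi)).

(* Main.v *)
(** The two-valued connectives can express, in each of the four logics, that an
    atom takes a given one of the three values.  Writing the projection of the
    models of [phi] onto the atoms shared with [psi] as a disjunction of such
    descriptions gives the interpolant.  The constants needed for the empty
    description are built from one shared atom, which exists because otherwise
    a model of [phi] and a countermodel of [psi] could be glued together. *)
Require Import Defs.
From mathcomp Require Import all_boot.

Set Implicit Arguments.
Unset Strict Implicit.
Unset Printing Implicit Defensive.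

Lemma designated_tand (L : logic) (x y : Defs.tval) :
  designated L (tand L x y) = designated L x && designated L y.
Proof. by case: L x y => [] [] []. Qed.

Lemma designated_tor (L : logic) (x y : Defs.tval) :
  designated L (tor L x y) = designated L x || designated L y.
Proof. by case: L x y => [] [] []. Qed.

Fixpoint eval (A : Type) (L : logic) (v : A -> Defs.tval) (phi : form A) : Defs.tval :=
  match phi with
  | Atom p => v p
  | Neg phi1 => tneg L (eval L v phi1)
  | And phi1 phi2 => tand L (eval L v phi1) (eval L v phi2)
  | Or phi1 phi2 => tor L (eval L v phi1) (eval L v phi2)
  | Imp phi1 phi2 => timp L (eval L v phi1) (eval L v phi2)
  end.

Lemma eval_homomorphism (A : Type) (L : logic) (v : A -> Defs.tval) :
  homomorphism L (eval L v).
Proof. by []. Qed.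

Lemma homomorphism_eval (A : Type) (L : logic) (h : form A -> Defs.tval) :
  homomorphism L h -> h =1 eval L (h \o @Atom A).
Proof.
case=> hN hA hO hI; elim=> //= [phi1 IH1|phi1 IH1 phi2 IH2|phi1 IH1 phi2 IH2|phi1 IH1 phi2 IH2].
- by rewrite hN IH1.
- by rewrite hA IH1 IH2.
- by rewrite hO IH1 IH2.
- by rewrite hI IH1 IH2.
Qed.

(** Homomorphisms are exactly the extensions of valuations of atoms; valuations can be glued and
    updated atom by atom. *)
Lemma entails_eval (A : Type) (L : logic) (phi psi : form A) :
  entails L phi psi <->
  forall v, designated L (eval L v phi) -> designated L (eval L v psi).
Proof.
split=> [ent v|ent h hom]; first exact: ent (eval_homomorphism L v).
by rewrite !(homomorphism_eval hom); apply: ent.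
Qed.

(** Binary connectives never return [Vu]. So [And a a] and the like collapse [Vu] before a negation
    is applied, which lets one formula serve both negations of each pair, although Kleene negation
    fixes [Vu]. *)
Definition value_is (A : Type) (L : logic) (x : Defs.tval) (p : A) : form A :=
  let a := Atom p in
  match L, x with
  | (I1 | I2), V1 => a
  | (I1 | I2), V0 => Neg a
  | (I1 | I2), Vu => Neg (Or a (Neg a))
  | (P1 | P2), V0 => Neg (And a a)
  | (P1 | P2), Vu => And a (Neg a)
  | (P1 | P2), V1 => Neg (And (Neg a) (Neg a))
  end.

Lemma value_isP (A : Type) (L : logic) (x : Defs.tval) (p : A) (v : A -> Defs.tval) :
  designated L (eval L v (value_is L x p)) <-> v p = x.
Proof. by case: L; case: x => /=; case: (v p). Qed.

(** [Imp p p] takes the value [V1] in all four logics, whatever [p] is, so its negation is always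
    [V0]. *)
Definition bool_form (A : Type) (p : A) (b : bool) : form A :=
  let top := Imp (Atom p) (Atom p) in if b then top else Neg top.

Lemma designated_bool_form (A : Type) (L : logic) (p : A) (b : bool) v :
  designated L (eval L v (bool_form p b)) = b.
Proof. by case: L b => [] [] /=; case: (v p). Qed.

Section Atoms.
Variables (A : eqType) (L : logic).
Implicit Types (phi psi : form A) (v w : A -> Defs.tval) (p q : A).

Lemma eq_in_eval phi v w : {in atoms phi, v =1 w} -> eval L v phi = eval L w phi.
Proof.
elim: phi => /= [p|phi IH|phi IH psi JH|phi IH psi JH|phi IH psi JH] eqvw.
- by apply: eqvw; rewrite mem_head.
- by rewrite IH.
all: by rewrite IH ?JH // => p pin; apply: eqvw; rewrite mem_cat pin ?orbT.
Qed.

Lemma atoms_value_is x p : {subset atoms (value_is L x p) <= [:: p]}.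
Proof. by move=> q; case: L x => [] [] /=; rewrite !inE ?orbb. Qed.

Lemma contingent_entails_share phi psi :
  contingent L phi -> contingent L psi -> entails L phi psi ->
  has [in atoms psi] (atoms phi).
Proof.
move=> [[h [hom hphi]] _] [_ [k [kom kpsi]]] /entails_eval ent.
apply: contraNT kpsi => /hasPn disj.
(* With disjoint atoms, [v] acts as the countermodel [k] on [psi] and as the model [h] on [phi]. *)
pose v q := if q \in atoms psi then k (Atom q) else h (Atom q).
have <-: eval L v psi = k psi.
  by rewrite (homomorphism_eval kom); apply: eq_in_eval => q; rewrite /v => ->.
apply: ent; rewrite (@eq_in_eval _ _ (h \o @Atom A)) -?(homomorphism_eval hom) //.
by move=> q /disj; rewrite /v /= => /negPf ->.
Qed.

Definition update v p x q := if q == p then x else v q.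

(* Existentially quantifies the atoms of [l] outside [keep]; atoms outside [l]
   are read off from [v]. *)
Fixpoint project (p0 : A) (keep : pred A) phi (l : seq A) v : form A :=
  if l is p :: l' then
    let branch x :=
      let chi := project p0 keep phi l' (update v p x) in
      if keep p then And (value_is L x p) chi else chi in
    Or (branch V0) (Or (branch Vu) (branch V1))
  else bool_form p0 (designated L (eval L v phi)).

(** Here [w] interprets the formula, while [v] stores the values chosen so far; the induction on [l]
    generalizes over [v]. *)
Lemma projectP p0 (keep : pred A) phi l v w :
  designated L (eval L w (project p0 keep phi l v)) <->
  exists u, [/\ {in l, forall q, keep q -> u q = w q},
                forall q, q \notin l -> u q = v q & designated L (eval L u phi)].
Proof.
elim: l v => [|p l IH] v.
  rewrite designated_bool_form; split=> [dv|[u [_ uv]]]; first by exists v.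
  by rewrite (@eq_in_eval phi u v) // => q _; apply: uv.
pose branch x := let chi := project p0 keep phi l (update v p x) in
  if keep p then And (value_is L x p) chi else chi.
rewrite -[project _ _ _ _ _]/(Or (branch V0) (Or (branch Vu) (branch V1))).
have branchP x : designated L (eval L w (branch x)) <->
    (keep p -> w p = x) /\
    designated L (eval L w (project p0 keep phi l (update v p x))).
  rewrite /branch; case: (keep p); last by split=> [|[]].
  rewrite /= designated_tand; split=> [/andP[/value_isP wp ->]|[wp ->]] //.
  by rewrite andbT; apply/value_isP/wp.
apply: (@iff_trans _ (exists x, designated L (eval L w (branch x)))).
  rewrite /= !designated_tor.
  split=> [/or3P[] dx|[[]->]]; rewrite ?orbT //; by [exists V0|exists Vu|exists V1].
split=> [[x /branchP[wp /IH[u [uw uv du]]]]|[u [uw uv du]]].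
  exists u; split=> // q; rewrite inE.
    (* The list may repeat [p]; a later choice then overrides [x], so membership in [l] is tested
       before equality with [p]. *)
    have [ql _|qnl] := boolP (q \in l); first exact: uw.
    rewrite orbF => /eqP qp kq; rewrite uv // /update qp eqxx wp //.
    by rewrite -qp.
  by rewrite negb_or => /andP[/negPf qp /uv]; rewrite /update qp.
exists (u p); apply/branchP; split.
  by move=> kp; rewrite uw ?mem_head.
apply/IH; exists u; split=> // q ql; first by apply: uw; rewrite inE ql orbT.
rewrite /update; case: eqP => [->//|/eqP qp]; apply: uv.
by rewrite inE negb_or qp.
Qed.

(** The leaves contribute [p0], and the descriptions of values contribute kept atoms. *)
Lemma atoms_project p0 (keep : pred A) phi l v :
  {subset atoms (project p0 keep phi l v) <= p0 :: filter keep l}.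
Proof.
elim: l v => [|p l IH] v q.
  by rewrite /= /bool_form; case: ifP => _; rewrite /= !inE ?orbb.
rewrite /= !mem_cat; case: ifP => kp; last by case/or3P; apply: IH.
have sub x : q \in atoms (And (value_is L x p) (project p0 keep phi l (update v p x))) ->
    q \in [:: p0, p & filter keep l].
  rewrite /= mem_cat !inE => /orP[/atoms_value_is|/IH].
    by rewrite inE => ->; rewrite orbT.
  by rewrite inE => /orP[]->; rewrite ?orbT.
by case/or3P; apply: sub.
Qed.

End Atoms.

Theorem mainTheorem4 (A : eqType) (L : logic) (phi psi : form A)
    (phi_contingent : contingent L phi) (psi_contingent : contingent L psi)
    (phi_entails_psi : entails L phi psi) :
  {chi : form A |
    [/\ forall p : A, p \in atoms chi -> p \in atoms phi /\ p \in atoms psi,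
        entails L phi chi & entails L chi psi]}.
Proof.
have := contingent_entails_share phi_contingent psi_contingent phi_entails_psi.
rewrite has_filter.
case shE: (filter _ _) => [//|p0 s] _.
(* The head [p0] of the list of shared atoms builds the constants. The default [V0] is harmless:
   every atom of [phi] is assigned before a leaf is reached. *)
exists (project L p0 [in atoms psi] phi (atoms phi) (fun=> V0)); split.
- move=> p /atoms_project pin; apply/andP; rewrite andbC -mem_filter.
  by move: pin; rewrite inE shE => /predU1P[->|//]; rewrite mem_head.
- apply/entails_eval => v dv; apply/projectP.
  (* Off [phi] the witness must equal the starting valuation, hence [V0]. *)
  exists (fun q => if q \in atoms phi then v q else V0).
  split=> [q -> //|q /negPf -> //|].
  by rewrite (@eq_in_eval _ _ _ _ v) // => q ->.
- apply/entails_eval => w /projectP[u [uw _ du]].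
  (* By [uw], [u] and [w] agree on shared atoms, so [v] matches [w] on [psi] and [u] on [phi]. *)
  pose v q := if q \in atoms psi then w q else u q.
  have <-: eval L v psi = eval L w psi.
    by apply: eq_in_eval => q; rewrite /v => ->.
  move/entails_eval: phi_entails_psi; apply.
  rewrite (@eq_in_eval _ _ _ _ u) // => q qphi; rewrite /v.
  by case: ifP => // qpsi; rewrite uw.
Qed.
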